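(* For every integer $k \geq 1$ there exists a positive integer $n$ such that the following holds. If $\mathcal{M}$ is a unital $*$-subalgebra of $M_n(\mathbb{C})$ and $\mathcal{V} \subseteq M_n(\mathbb{C})$ is an operator system satisfying $\mathcal{M}'\mathcal{V}\mathcal{M}' = \mathcal{V}$, then there is an orthogonal projection $P \in \mathcal{M}$ whose rank is at least $k$ and such that $P\mathcal{V}P = PM_n(\mathbb{C})P$ or $P\mathcal{V}P = P\mathcal{M}'P$.
   Context: An operator system in $M_n(\mathbb{C})$ is a complex linear subspace $\mathcal{V} \subseteq M_n(\mathbb{C})$ such that $I_n \in \mathcal{V}$ and $A \in \mathcal{V}$ implies $A^* \in \mathcal{V}$. A unital $*$-subalgebra of $M_n(\mathbb{C})$ is a complex subalgebra containing $I_n$ and closed under Hermitian adjoint. The commutant of $\mathcal{M}$ is $\mathcal{M}' = \{A \in M_n(\mathbb{C}) : AB = BA \text{ for all } B \in \mathcal{M}\}$. The condition $\mathcal{M}'\mathcal{V}\mathcal{M}' = \mathcal{V}$ means that $\mathcal{V}$ is stable under left and right multiplication by elements of $\mathcal{M}'$, i.e. $AXB \in \mathcal{V}$ for all $A, B \in \mathcal{M}'$ and $X \in \mathcal{V}$. An orthogonal projection is a matrix $P$ with $P = P^2 = P^*$. For a set $\mathcal{S}$ of matrices, $P\mathcal{S}P = \{PAP : A \in \mathcal{S}\}$. *)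

(* Defs.v *)
From HB Require Import structures.
From mathcomp Require Import all_boot all_order all_algebra all_field.
From mathcomp Require Import complex reals.

Set Implicit Arguments.
Unset Strict Implicit.
Unset Printing Implicit Defensive.

Import GRing.Theory Num.Theory.
Local Open Scope ring_scope.
Local Open Scope complex_scope.
Local Open Scope sesquilinear_scope.

(* Complex matrices are 'M[R[i]]_m.+1 with R : realType: the positive size
   m.+1 makes the matrices an algebra, so that {vspace _} and the commutant
   'C(M)%VS of falgebra.v apply.  A ^t* is the Hermitian adjoint.             *)

Definition adjoint_closed (R : realType) (m : nat)
    (V : {vspace 'M[R[i]]_m.+1}) : Prop :=
  forall A : 'M[R[i]]_m.+1, A \in V -> A ^t* \in V.

Definition operator_system (R : realType) (m : nat)
    (V : {vspace 'M[R[i]]_m.+1}) : Prop :=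
  1%:M \in V /\ adjoint_closed V.

Definition unital_star_subalgebra (R : realType) (m : nat)
    (M : {vspace 'M[R[i]]_m.+1}) : Prop :=
  [/\ 1%:M \in M,
      (forall A B : 'M[R[i]]_m.+1, A \in M -> B \in M -> A *m B \in M)
    & adjoint_closed M].

Definition bimodule_over (R : realType) (m : nat)
    (N V : {vspace 'M[R[i]]_m.+1}) : Prop :=
  forall A X B : 'M[R[i]]_m.+1,
    A \in N -> X \in V -> B \in N -> A *m X *m B \in V.

Definition orthogonal_projection (R : realType) (m : nat)
    (P : 'M[R[i]]_m.+1) : Prop :=
  P *m P = P /\ P ^t* = P.

(* P S P = {P A P : A in S} as a subspace; see compressionP.                  *)
Definition compression (R : realType) (m : nat) (P : 'M[R[i]]_m.+1)
    (S : {vspace 'M[R[i]]_m.+1}) : {vspace 'M[R[i]]_m.+1} :=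
  ((amull P \o amulr P) @: S)%VS.

Lemma compressionP (R : realType) (m : nat) (P : 'M[R[i]]_m.+1)
    (S : {vspace 'M[R[i]]_m.+1}) (X : 'M[R[i]]_m.+1) :
  reflect (exists2 A, A \in S & X = P *m A *m P) (X \in compression P S).
Proof.
apply: (iffP memv_imgP) => -[A AS ->]; exists A => //;
  by rewrite comp_lfunE !lfunE /= -mulmxA.
Qed.

(* Main.v *)
(* An arbitrary subspace V of M_n closed under adjoints is handled as follows.
   Choose a k x n matrix T maximizing the dimension of T V T^*. If T V T^* is
   all of M_k we have a clique. Otherwise perturbing T shows that every A in V
   with T A T^* = 0 has rank at most 4k, and a space of matrices of bounded
   rank vanishes after compression to a subspace of bounded codimension; so V
   has a large compression spanned by at most 2k^2 Hermitian matrices. These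
   are made scalar one at a time, by pairing eigenvectors whose eigenvalues lie
   on both sides of the median.

   For a general algebra M, an element of minimal rank yields minimal
   projections, hence a long orthogonal family p_1, p_2, ... of them; if one of
   them has rank at least k it already works. Otherwise the graph Ramsey theorem
   applied to the relation p_i M p_j <> 0 gives either many equivalent p_i, where
   V is governed by a subspace of M_r to which the first part applies, or many
   inequivalent p_i, where a second use of the graph Ramsey theorem, for the
   relation p_i V p_j <> 0, finishes. The averaging map
   X |-> \sum_l b_l X b_l^*, with b an orthonormal basis of M for the trace inner
   product, produces the needed elements of the commutant. *)
Require Import Defs.
From HB Require Import structures.
From mathcomp Require Import all_boot all_order all_algebra all_field.
From mathcomp Require Import complex reals boolp zify ring.

Set Implicit Arguments.
Unset Strict Implicit.
Unset Printing Implicit Defensive.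

Import Order.TTheory GRing.Theory Num.Theory.
Local Open Scope ring_scope.
Local Open Scope sesquilinear_scope.

(** * Adjoints, polarization, perturbation of full row rank, Gram-Schmidt *)

Section MatrixPreliminaries.
Variable C : numClosedFieldType.

Lemma adjointM m n p (A : 'M[C]_(m, n)) (B : 'M[C]_(n, p)) :
  (A *m B) ^t* = B ^t* *m A ^t*.
Proof. by rewrite trmx_mul map_mxM. Qed.

Lemma adjointD m n (A B : 'M[C]_(m, n)) : (A + B) ^t* = A ^t* + B ^t*.
Proof. by rewrite linearD /= map_mxD. Qed.

Lemma adjointZ m n (c : C) (A : 'M[C]_(m, n)) : (c *: A) ^t* = c^* *: A ^t*.
Proof. by rewrite linearZ /= map_mxZ. Qed.

Lemma adjointB m n (A B : 'M[C]_(m, n)) : (A - B) ^t* = A ^t* - B ^t*.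
Proof. by rewrite linearB /= map_mxB. Qed.

Lemma adjoint0 m n : (0 : 'M[C]_(m, n)) ^t* = 0.
Proof. by rewrite trmx0 map_mx0. Qed.

Lemma adjoint1 n : (1%:M : 'M[C]_n) ^t* = 1%:M.
Proof. by rewrite trmx1 map_mx1. Qed.

Lemma adjoint_sum (I : Type) (r : seq I) (P : pred I) m n (F : I -> 'M[C]_(m, n)) :
  (\sum_(i <- r | P i) F i) ^t* = \sum_(i <- r | P i) (F i) ^t*.
Proof.
by elim/big_rec2: _ => [|i y x _ <-]; rewrite ?adjoint0 ?adjointD.
Qed.

Lemma mulmx_adjoint_eq0 m n (A : 'M[C]_(m, n)) : (A *m A ^t* == 0) = (A == 0).
Proof.
apply/eqP/eqP => [A0|->]; last by rewrite mul0mx.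
apply/row_matrixP => i; rewrite row0; apply/eqP; apply: contraT => nz.
have := dotmx_is_dotmx nz; rewrite dotmxE.
suff -> : row i A *m (row i A) ^t* = 0 by rewrite mxE ltxx.
by rewrite rowE adjointM mulmxA -(mulmxA _ A) A0 mulmx0 mul0mx.
Qed.

(** Expanding the form at [x + c *: y] for [c = 1] and [c = 'i] isolates twice the cross term
    [x *m B *m y ^t*], and matrix entries are such cross terms. *)
Lemma polarization n (B : 'M[C]_n) :
  (forall x : 'rV_n, x *m B *m x ^t* = 0) -> B = 0.
Proof.
move=> B0.
have cross (x y : 'rV_n) : x *m B *m y ^t* = 0.
  have xy c : c^* *: (x *m B *m y ^t*) + c *: (y *m B *m x ^t*) = 0.
    have := B0 (x + c *: y).
    rewrite adjointD adjointZ !mulmxDl !mulmxDr -!scalemxAr -!scalemxAl.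
    by rewrite !B0 !scaler0 add0r addr0.
  have e1 := xy 1; rewrite conjC1 !scale1r in e1.
  have e2 := congr1 ( *:%R 'i) (xy 'i).
  rewrite conjCi scalerDr !scalerA mulrN -expr2 sqrCi opprK scale1r in e2.
  rewrite scaler0 scaleN1r in e2.
  have := congr2 +%R e1 e2; rewrite addr0 addrACA subrr addr0 -mulr2n.
  by move/eqP; rewrite -scaler_nat scaler_eq0 pnatr_eq0 /= => /eqP.
apply/matrixP => i j; rewrite mxE.
have := cross (delta_mx 0 i) (delta_mx 0 j).
rewrite -rowE trmx_delta map_delta_mx -colE.
by move/matrixP/(_ 0 0); rewrite !mxE.
Qed.

(* The determinant of [(F0 + t F1 + t^2 F2) G], for [G] a right inverse of
   [F0], is a polynomial in [t] that is nonzero at [0]. *)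
Lemma row_free_perturb m n (F0 F1 F2 : 'M[C]_(m, n)) : row_free F0 ->
  exists t : C, [/\ t^* = t, t != 0 & row_free (F0 + t *: F1 + t ^+ 2 *: F2)].
Proof.
case/row_freeP => G F0G.
pose lift (F : 'M[C]_(m, n)) := map_mx polyC (F *m G).
pose p := \det (lift F0 + 'X *: lift F1 + 'X^2 *: lift F2).
have hornp t : p.[t] = \det ((F0 + t *: F1 + t ^+ 2 *: F2) *m G).
  rewrite -horner_evalE -det_map_mx; congr (\det _).
  apply/matrixP => i j.
  rewrite !mulmxDl -!scalemxAl !mxE /= /horner_eval.
  by rewrite !hornerE.
have p0 : p != 0.
  apply/eqP => p0; have := hornp 0.
  rewrite p0 horner0 scale0r expr0n /= scale0r !addr0 F0G det1.
  by move/eqP; rewrite eq_sym oner_eq0.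
(* Positive integers are real and nonzero, and [size p] of them cannot all be roots of [p]. *)
have [j pj] : exists j : nat, p.[j.+1%:R] != 0.
  pose s := [seq (j.+1%:R : C) | j <- iota 0 (size p)].
  have /allPn[x /mapP[j _ ->] pj] : ~~ all (root p) s.
    apply/negP => roots_s; have := max_poly_roots p0 roots_s.
    rewrite size_map size_iota ltnn; move/(_ _)/negP; apply=> //.
    rewrite map_inj_uniq ?iota_uniq // => a b /eqP.
    by rewrite eqr_nat eqSS => /eqP.
  by exists j.
exists j.+1%:R; split; [exact: conjC_nat | by rewrite pnatr_eq0 |].
rewrite hornp -unitfE -unitmxE in pj.
set F := F0 + _ + _ in pj *; apply/row_freeP; exists (G *m invmx (F *m G)).
by rewrite mulmxA mulmxV.
Qed.

Lemma row_free_orthonormalize m n (A : 'M[C]_(m, n)) : row_free A ->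
  exists2 B : 'M[C]_m, B *m A \is unitarymx & (B *m A :=: A)%MS.
Proof.
move=> freeA; have eqA := eqmx_schmidt_free freeA.
have /submxP[B defS] : (schmidt A <= A)%MS by rewrite eqA.
exists B; rewrite -defS //; apply: schmidt_unitarymx.
by rewrite -(eqP (freeA : \rank A == m)) rank_leq_col.
Qed.

End MatrixPreliminaries.

(** * Extremal elements for a natural-number measure *)

Section Extrema.
Variables (X : Type) (P : X -> Prop) (f : X -> nat).

Lemma exists_maximizer (b : nat) : (exists x, P x) ->
  (forall x, P x -> f x <= b)%N ->
  exists2 x, P x & forall y, P y -> (f y <= f x)%N.
Proof.
move=> [x0 Px0] fb; pose Q n := `[< exists2 x, P x & f x = n >].
have exQ : exists n, Q n by exists (f x0); apply/asboolP; exists x0.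
have Qb n : Q n -> (n <= b)%N by move/asboolP => [x Px <-]; apply: fb.
case: (ex_maxnP exQ Qb) => n /asboolP[x Px fx] max.
by exists x => // y Py; rewrite fx; apply: max; apply/asboolP; exists y.
Qed.

Lemma exists_minimizer : (exists x, P x) ->
  exists2 x, P x & forall y, P y -> (f x <= f y)%N.
Proof.
move=> [x0 Px0]; pose Q n := `[< exists2 x, P x & f x = n >].
have exQ : exists n, Q n by exists (f x0); apply/asboolP; exists x0.
case: (ex_minnP exQ) => n /asboolP[x Px fx] min.
by exists x => // y Py; rewrite fx; apply: min; apply/asboolP; exists y.
Qed.

End Extrema.

(** * Operator systems in full matrix algebras *)

Section QuantumRamsey.
Variable C : numClosedFieldType.

Lemma row_free_mxvec k l s (X : s.-tuple 'M[C]_(k, l)) :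
  row_free (\matrix_i mxvec (tnth X i)) = free X.
Proof.
have lin (v : 'rV[C]_s) : v *m (\matrix_i mxvec (tnth X i))
    = mxvec (\sum_i v 0 i *: X`_i).
  rewrite mulmx_sum_row linear_sum; apply: eq_bigr => i _.
  by rewrite rowK linearZ (tnth_nth 0).
apply/idP/freeP => [rf c c0 i | fr].
  have /matrixP/(_ 0 i) : (\row_j c j) = 0 :> 'rV_s.
    apply: (row_free_inj rf); rewrite mul0mx lin.
    rewrite [X in mxvec X](_ : _ = 0) ?linear0 // -[RHS]c0.
    by apply: eq_bigr => j _; rewrite mxE.
  by rewrite !mxE.
apply: inj_row_free => v; rewrite lin => /(congr1 vec_mx).
rewrite mxvecK linear0 => v0; apply/rowP => j; rewrite mxE.
exact: (fr (fun i => v 0 i)).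
Qed.

(** If the corner entry were nonzero, pairing with [y ^t*] shows that a row basis of [A] stays free
    when [x *m B] is added. For a suitable nonzero [t], a perturbation of these rows is still free
    and lies in the row space of [A + t *: B], whose rank would exceed that of [A]. *)
Lemma max_rank_corner n (W : {vspace 'M[C]_n}) (A B : 'M[C]_n) (x y : 'rV_n) :
    A \in W -> (forall A', A' \in W -> \rank A' <= \rank A)%N -> B \in W ->
  x *m A = 0 -> A *m y ^t* = 0 -> x *m B *m y ^t* = 0.
Proof.
move=> AW maxA BW xA Ay; apply/eqP; apply: contraT => nz.
have /submxP[D defD] : (row_base A <= A)%MS by rewrite eq_row_base.
pose F0 := col_mx (row_base A) (x *m B).
pose F1 := col_mx (D *m B) (0 : 'rV_n).
have F0free : row_free F0.
  apply: inj_row_free => v; rewrite -[v]hsubmxK mul_row_col => v0.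
  have r0 : rsubmx v = 0.
    have := congr1 (mulmx^~ (y ^t*)) v0.
    rewrite mulmxDl -mulmxA defD -(mulmxA D) Ay !mulmx0 add0r mul0mx.
    rewrite -mulmxA => /eqP; rewrite [rsubmx v]mx11_scalar mul_scalar_mx.
    by rewrite scaler_eq0 (negPf nz) orbF => /eqP->; rewrite raddf0.
  rewrite r0 mul0mx addr0 in v0.
  rewrite r0 (row_free_inj (row_base_free A) (etrans v0 (esym (mul0mx _ _)))).
  exact: row_mx0.
have [t [_ t0]] := row_free_perturb F1 0 F0free.
rewrite scaler0 addr0 => freeF.
have sub : ((F0 + t *: F1)%R <= (A + t *: B)%R)%MS.
  rewrite /F0 /F1 scale_col_mx add_col_mx scaler0 addr0 col_mx_sub.
  apply/andP; split.
    by rewrite defD scalemxAr -mulmxDr submxMl.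
  suff -> : x *m B = t^-1 *: x *m (A + t *: B) by apply: submxMl.
  by rewrite mulmxDr -!scalemxAl xA scaler0 add0r -scalemxAr scalerA mulVf ?scale1r.
have := mxrankS sub; rewrite (eqP freeF) addn1 => rk.
have /maxA : A + t *: B \in W by rewrite memvD ?memvZ.
by move/(leq_trans rk); rewrite ltnn.
Qed.

Definition conjugation k n (T : 'M[C]_(k, n)) : 'Hom('M[C]_n, 'M[C]_k) :=
  linfun (mulmxr (T ^t*) \o mulmx T).

Lemma conjugationE k n (T : 'M[C]_(k, n)) A : conjugation T A = T *m A *m T ^t*.
Proof. by rewrite lfunE. Qed.

(** Polarization produces every [h *m g ^t*], hence the matrix units. *)
Lemma rank_one_spanning k (Y : {vspace 'M[C]_k}) :
  (forall h : 'cV_k, h *m h ^t* \in Y) -> Y = fullv.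
Proof.
move=> hY; apply/eqP; rewrite eqEsubv subvf; apply/subvP => X _.
have dY (h g : 'cV_k) : h *m g ^t* \in Y.
  have hg c : c^* *: (h *m g ^t*) + c *: (g *m h ^t*) \in Y.
    have := hY (h + c *: g).
    rewrite adjointD adjointZ !mulmxDl !mulmxDr -!scalemxAr -!scalemxAl.
    by rewrite -addrA rpredDl // addrA rpredDr // !memvZ.
  have e1 := hg 1; rewrite conjC1 !scale1r in e1.
  have e2 := memvZ 'i (hg 'i).
  rewrite conjCi scalerDr !scalerA mulrN -expr2 sqrCi opprK scale1r in e2.
  rewrite scaleN1r in e2.
  have := memvD e1 e2; rewrite addrACA subrr addr0 -mulr2n -scaler_nat.
  by move/(memvZ 2^-1); rewrite scalerA mulVf ?pnatr_eq0 // scale1r.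
rewrite [X]matrix_sum_delta; apply: memv_suml => i _; apply: memv_suml => j _.
apply: memvZ; have := dY (delta_mx i 0) (delta_mx j 0).
by rewrite trmx_delta map_delta_mx mul_delta_mx.
Qed.

(* Let [S = h x] for a column [h]. If [S A S^*] were not in the image of [W]
   under conjugation by [T], conjugation by [T + t S] with [t] small would have
   a larger image: a basis of the old image stays free, and [A] contributes
   [t^2 S A S^*]. *)
Lemma maximal_image_vanish k n (W : {vspace 'M[C]_n}) (T : 'M[C]_(k, n)) :
    (forall T' : 'M_(k, n),
      \dim (conjugation T' @: W) <= \dim (conjugation T @: W))%N ->
    (conjugation T @: W)%VS != fullv ->
  forall (A : 'M_n) (x : 'rV_n), A \in W -> T *m A *m T ^t* = 0 ->
    x *m A *m T ^t* = 0 -> T *m A *m x ^t* = 0 -> x *m A *m x ^t* = 0.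
Proof.
set Y := (_ @: W)%VS => maxT properY A x AW TAT xAT TAx.
apply/eqP; apply: contraT => nz; case/negP: properY.
apply/eqP/rank_one_spanning => h.
pose S := h *m x; pose s := S *m A *m S ^t*.
have defs : s = (x *m A *m x ^t*) 0 0 *: (h *m h ^t*).
  have -> : s = h *m (x *m A *m x ^t*) *m h ^t*.
    by rewrite /s /S adjointM !mulmxA.
  by rewrite [in LHS](mx11_scalar (x *m A *m _)) mul_mx_scalar -scalemxAl.
suff sY : s \in Y.
  move: sY; rewrite defs => /(memvZ ((x *m A *m x ^t*) 0 0)^-1).
  rewrite scalerA mulVf ?scale1r //; apply: contraNneq nz => z.
  by rewrite [x *m A *m _]mx11_scalar z raddf0.
apply: contraT => sY.
pose b := vbasis Y.
have exA i : {B | B \in W & tnth b i = T *m B *m T ^t*}.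
  apply: cid2.
  have /vbasis_mem/memv_imgP[B BW ->] := mem_tnth i b.
  by exists B; rewrite ?conjugationE.
pose F0 := \matrix_i mxvec (tnth [tuple of s :: b] i).
have F0free : row_free F0.
  rewrite row_free_mxvec /= free_cons (basis_free (vbasisP Y)).
  by rewrite (span_basis (vbasisP Y)) sY.
pose B i := s2val (exA i).
pose F1 := \matrix_i
  oapp (fun j => mxvec (S *m B j *m T ^t* + T *m B j *m S ^t*)) 0 (unlift 0 i).
pose F2 := \matrix_i oapp (fun j => mxvec (S *m B j *m S ^t*)) 0 (unlift 0 i).
have [t [tr t0 freeF]] := row_free_perturb F1 F2 F0free.
pose Tt := T + t *: S.
(* These are the rows of the perturbed [F0]: the hypotheses on [A] and [x] cancel the terms of order
   0 and 1 in [t], so dividing by [t ^+ 2] leaves exactly [s]. All lie in the image under [Tt], one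
   more than the maximal dimension. *)
pose z : (\dim Y).+1.-tuple 'M[C]_k :=
  [tuple oapp (fun j => conjugation Tt (B j)) (t ^- 2 *: conjugation Tt A)
           (unlift 0 i) | i < (\dim Y).+1].
have zfree : free z.
  rewrite -row_free_mxvec.
  suff <- : F0 + t *: F1 + t ^+ 2 *: F2 = \matrix_i mxvec (tnth z i) by [].
  have expand D : conjugation Tt D = T *m D *m T ^t*
      + t *: (S *m D *m T ^t* + T *m D *m S ^t*) + t ^+ 2 *: (S *m D *m S ^t*).
    rewrite conjugationE /Tt adjointD adjointZ tr !mulmxDl !mulmxDr.
    rewrite -!scalemxAr -!scalemxAl scalerA -expr2 scalerDr !addrA.
    by congr (_ + _); rewrite -!addrA; congr (_ + _); rewrite addrC.
  apply/row_matrixP => i; rewrite !linearD !linearZ /= !rowK tnth_mktuple.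
  case: unliftP => [j|] -> /=.
    by rewrite tnthS expand (s2valP' (exA j)) !linearD /= !linearZ.
  rewrite tnth0 expand TAT add0r !scaler0 !addr0.
  rewrite /S adjointM !mulmxA -(mulmxA h) -(mulmxA h) xAT mulmx0 add0r.
  rewrite TAx mul0mx scaler0 add0r scalerA mulVf ?scale1r ?expf_neq0 //.
  by rewrite /s /S adjointM !mulmxA.
have subz : (<<z>> <= conjugation Tt @: W)%VS.
  apply/span_subvP => _ /tnthP[i ->]; rewrite tnth_mktuple.
  by case: unlift => [j|] /=; rewrite ?memvZ ?memv_img // (s2valP (exA j)).
have := leq_trans (dimvS subz) (maxT Tt).
by rewrite (eqP (zfree : \dim _ == _)) size_tuple ltnn.
Qed.

(** After sorting, the [i]-th entry is paired with the [(k + i)]-th. The [k]-th smallest entry lies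
    between them, so some unit vector in their coordinate plane gives the quadratic form that value.
    Disjoint supports make the off-diagonal entries vanish. *)
Lemma diag_scalar_compression k n (d : 'rV[C]_n) :
    d \is a mxOver Num.real -> (k.*2 <= n)%N ->
  exists2 T : 'M[C]_(k, n), T \is unitarymx &
    exists c, T *m diag_mx d *m T ^t* = c%:M.
Proof.
move=> /mxOverP dreal; case: k => [|k] le_kn.
  exists 0; last by exists 0; apply/matrixP => -[].
  by apply/unitarymxP/matrixP => -[].
have n0 : (0 < n)%N by apply: leq_trans le_kn.
pose s := sort (fun i j => d 0 i <= d 0 j) (enum 'I_n).
have size_s : size s = n by rewrite size_sort size_enum_ord.
have s_uniq : uniq s by rewrite sort_uniq enum_uniq.
pose f i := nth (Ordinal n0) s i.
have d_mono i j : (i <= j)%N -> (j < n)%N -> d 0 (f i) <= d 0 (f j).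
  move=> le_ij lt_jn.
  have s_sorted : sorted (fun i j => d 0 i <= d 0 j) s.
    apply: (@sort_sorted_in _ predT); last by apply/allP.
    by move=> a b _ _; apply: real_leVge; apply: dreal.
  apply: (@sorted_leq_nth _ (fun i j => d 0 i <= d 0 j)) => //.
  - by move=> a b c; apply: le_trans.
  - by rewrite inE size_s (leq_ltn_trans le_ij).
  - by rewrite inE size_s.
have f_inj i j : (i < n)%N -> (j < n)%N -> (f i == f j) = (i == j).
  by move=> *; rewrite nth_uniq ?size_s.
have lt1 (i : 'I_k.+1) : (i < n)%N by have := ltn_ord i; lia.
have lt2 (i : 'I_k.+1) : (k.+1 + i < n)%N by have := ltn_ord i; lia.
pose c := d 0 (f k).
have weights (i : 'I_k.+1) : exists w : C * C,
    [/\ w.1^* = w.1, w.2^* = w.2, w.1 ^+ 2 + w.2 ^+ 2 = 1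
     & w.1 ^+ 2 * d 0 (f i) + w.2 ^+ 2 * d 0 (f (k.+1 + i)) = c].
  pose a := d 0 (f i); pose b := d 0 (f (k.+1 + i)%N).
  have le_ac : a <= c by apply: d_mono; have := ltn_ord i; lia.
  have le_cb : c <= b by apply: d_mono; have := ltn_ord i; lia.
  have [l [l0 l1 lc]] : exists l, [/\ 0 <= l, l <= 1 & l * a + (1 - l) * b = c].
    have [eq_ab|ne_ab] := eqVneq a b.
      exists 1; rewrite ler01 lexx subrr mul0r addr0 mul1r; split=> //.
      by apply/le_anti; rewrite le_ac eq_ab le_cb.
    have lt_ab : a < b by rewrite lt_neqAle ne_ab (le_trans le_ac).
    have ba0 : 0 < b - a by rewrite subr_gt0.
    exists ((b - c) / (b - a)); split.
    - by rewrite divr_ge0 ?subr_ge0 // ltW.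
    - by rewrite ler_pdivrMr // mul1r lerD2l lerN2.
    - by field; rewrite lt0r_neq0.
  exists (sqrtC l, sqrtC (1 - l)); rewrite /= !sqrtCK !geC0_conj ?sqrtC_ge0 ?subr_ge0 //.
  by split=> //; ring.
have [w wP] := choice weights.
pose g (i : nat) := f (k.+1 + i)%N.
pose T := \matrix_(i < k.+1, j < n)
  ((w i).1 * (j == f i)%:R + (w i).2 * (j == g i)%:R).
(* Stated for every [e]: the constant row 1 gives orthonormality of the rows of [T], and [d] gives
   the scalar compression. *)
have Tdiag (e : 'rV[C]_n) i j : (T *m diag_mx e *m T ^t*) i j =
    ((w i).1 ^+ 2 * e 0 (f i) + (w i).2 ^+ 2 * e 0 (g i)) *+ (i == j).
  have pick (x : C) p (X : 'I_n -> C) : \sum_l x * (l == p)%:R * X l = x * X p.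
    rewrite (bigD1 p) //= eqxx mulr1 big1 ?addr0 // => l /negPf->.
    by rewrite mulr0 mul0r.
  rewrite mul_mx_diag !mxE.
  under eq_bigr => l _ do rewrite !mxE -mulrA mulrDl.
  rewrite big_split /= !pick /g !f_inj // ?lt1 ?lt2 //.
  have -> : (i == (k.+1 + j)%N :> nat) = false.
    by apply/negbTE; have := ltn_ord i; lia.
  have -> : ((k.+1 + i)%N == j :> nat) = false.
    by apply/negbTE; have := ltn_ord j; lia.
  rewrite eqn_add2l; have [<-|ne_ij] := eqVneq i j.
    have [e1 e2 _ _] := wP i.
    rewrite eqxx !mulr0 !mulr1 addr0 add0r e1 e2 mulr1n; ring.
  rewrite (_ : (i == j :> nat) = false) ?(negPf ne_ij) //=; last exact: negPf.
  by rewrite !mulr0 addr0 conjC0 !mulr0 addr0.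
exists T.
  apply/unitarymxP/matrixP => i j; rewrite -[X in X *m _]mulmx1 -diag_const_mx Tdiag !mxE.
  by rewrite !mulr1; have [_ _ -> _] := wP i.
exists c; apply/matrixP => i j; rewrite Tdiag !mxE.
by have [_ _ _ ->] := wP i.
Qed.

Lemma hermitian_scalar_compression k n (H : 'M[C]_n) :
    H ^t* = H -> (k.*2 <= n)%N ->
  exists2 T : 'M[C]_(k, n), T \is unitarymx & exists c, T *m H *m T ^t* = c%:M.
Proof.
move=> Hherm le_kn.
have hermH : H \is hermsymmx by rewrite is_hermitianmxE expr0 scale1r Hherm.
have /orthomx_spectralP defH := hermitian_normalmx hermH.
have := hermitian_spectral_diag_real hermH.
set P := spectralmx H in defH *; set d := spectral_diag H in defH *.
have uP : P \is unitarymx := spectral_unitarymx H.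
case/diag_scalar_compression/(_ le_kn) => Z /unitarymxP uZ [c ZdZ].
exists (Z *m P); first by rewrite mul_unitarymx //; apply/unitarymxP.
exists c; rewrite defH invmx_unitary // adjointM !mulmxA.
by rewrite !(mulmxtVK _ uP).
Qed.

(** Each matrix costs a factor of two in the size; compressing further along orthonormal rows keeps
    scalar compressions scalar. *)
Lemma hermitian_family_scalar_compression k n (Hs : seq 'M[C]_n) :
    (forall H, H \in Hs -> H ^t* = H) -> (k * 2 ^ size Hs <= n)%N ->
  exists2 T : 'M[C]_(k, n), T \is unitarymx &
    forall H, H \in Hs -> exists c, T *m H *m T ^t* = c%:M.
Proof.
elim: Hs k => [|H Hs IH] k herm le_kn.
  rewrite muln1 in le_kn; exists (schmidt 0) => //.
  by rewrite schmidt_unitarymx.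
case: (IH k.*2) => [X XHs||T1 uT1 T1P]; first by rewrite herm // inE XHs orbT.
  by rewrite -muln2 -mulnA -expnS.
have herm1 : (T1 *m H *m T1 ^t*) ^t* = T1 *m H *m T1 ^t*.
  by rewrite !adjointM trmxCK herm ?mem_head // mulmxA.
have [T2 uT2 [c T2P]] := hermitian_scalar_compression herm1 (leqnn _).
exists (T2 *m T1); first exact: mul_unitarymx.
move=> X; rewrite adjointM inE => /predU1P[->|/T1P[c' T1X]].
  by exists c; rewrite -T2P !mulmxA.
exists c'; transitivity (T2 *m (T1 *m X *m T1 ^t*) *m T2 ^t*).
  by rewrite !mulmxA.
by rewrite T1X mul_mx_scalar -scalemxAl (unitarymxP uT2) scalemx1.
Qed.

(** Take [A] of maximal rank in [W] and let the rows of [B] be an orthonormal basis of the common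
    left kernel of [A] and [A ^t*], of codimension at most [r.*2]. There [max_rank_corner] kills
    every quadratic form from [W], and polarization concludes. *)
Lemma small_rank_part_compression n r (W : {vspace 'M[C]_n}) :
    (forall A, A \in W -> A ^t* \in W) ->
    (forall A, A \in W -> \rank A <= r)%N ->
  exists2 l, (n - r.*2 <= l)%N & exists2 B : 'M[C]_(l, n), B \is unitarymx &
    forall A, A \in W -> B *m A *m B ^t* = 0.
Proof.
move=> adjW rankW.
have [|A AW maxA] := @exists_maximizer _ (fun A => A \in W) (fun A => \rank A) r _ rankW.
  by exists 0; apply: mem0v.
pose L := kermx (row_mx A (A ^t*)).
exists (\rank L).
  rewrite mxrank_ker leq_sub2l // -mxrank_tr tr_row_mx -addsmxE.
  rewrite (leq_trans (mxrank_adds_leqif _ _).1) //.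
  by rewrite !mxrank_tr mxrank_map mxrank_tr -addnn leq_add ?rankW.
have [S uB eqB] := row_free_orthonormalize (row_base_free L).
exists (S *m row_base L) => //= D DW; set B := S *m _ in uB eqB *.
apply: polarization => x.
have : (x *m B <= L)%MS by rewrite (submx_trans (submxMl _ _)) // eqB eq_row_base.
rewrite sub_kermx mul_mx_row -row_mx0 => /eqP/eq_row_mx[xA xA'].
have := max_rank_corner AW maxA DW xA.
move=> /(_ (x *m B)); rewrite adjointM !mulmxA; apply.
have := congr1 (fun Y => Y ^t*) xA'.
by rewrite !adjointM !trmxCK adjoint0 !mulmxA.
Qed.

(** On the common left kernel [K] of [A *m T ^t*] and [A ^t* *m T ^t*], of codimension at most
    [k.*2], [maximal_image_vanish] gives [K *m A *m K ^t* = 0]. Each of the two multiplications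
    lowers the rank by at most [k.*2]. *)
Lemma maximal_image_rank k n (W : {vspace 'M[C]_n}) (T : 'M[C]_(k, n)) :
    (forall T' : 'M_(k, n),
      \dim (conjugation T' @: W) <= \dim (conjugation T @: W))%N ->
    (conjugation T @: W)%VS != fullv ->
  forall A : 'M_n, A \in W -> T *m A *m T ^t* = 0 -> (\rank A <= 4 * k)%N.
Proof.
move=> maxT properT A AW TAT.
pose K := kermx (row_mx (A *m T ^t*) (A ^t* *m T ^t*)).
have rankK : (n - k.*2 <= \rank K)%N.
  by rewrite mxrank_ker leq_sub2l // -addnn rank_leq_col.
have KAK : K *m A *m K ^t* = 0.
  apply: polarization => x.
  have -> : x *m (K *m A *m K ^t*) *m x ^t* = (x *m K) *m A *m (x *m K) ^t*.
    by rewrite adjointM !mulmxA.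
  have : (x *m K <= K)%MS by apply: submxMl.
  move: (x *m K) => y.
  rewrite sub_kermx mul_mx_row -row_mx0 => /eqP/eq_row_mx[xA xA'].
  apply: (maximal_image_vanish maxT properT AW TAT); first by rewrite -mulmxA.
  have := congr1 (fun Y => Y ^t*) xA'.
  by rewrite !adjointM !trmxCK adjoint0.
have rankKc : \rank (K ^t*) = \rank K by rewrite mxrank_map mxrank_tr.
have := mxrank_mul_min K A; have := mxrank_mul_min (K *m A) (K ^t*).
by rewrite KAK mxrank0 rankKc; lia.
Qed.

(** The term [8 * k] is twice the rank bound [4 * k] of the kernel part, the loss in
    [small_rank_part_compression]. The exponent counts two Hermitian matrices for each basis vector
    of a complement of dimension at most [k * k], one halving each. *)
Theorem quantum_ramsey k n (W : {vspace 'M[C]_n}) :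
    (k * 2 ^ (2 * (k * k)) + 8 * k <= n)%N ->
    (forall A, A \in W -> A ^t* \in W) ->
  exists2 T : 'M[C]_(k, n), T \is unitarymx &
    (conjugation T @: W = fullv \/ conjugation T @: W <= <[1%:M]>)%VS.
Proof.
move=> le_n adjW.
have dimle (T : 'M[C]_(k, n)) : (\dim (conjugation T @: W) <= k * k)%N.
  by rewrite (leq_trans (dimvS (subvf _))) // dimvf.
have [|T _ maxT] := @exists_maximizer _ (fun=> True) _ _ _ (fun T _ => dimle T).
  by exists 0.
have {}maxT T' := maxT T' I.
have [full|proper] := eqVneq (conjugation T @: W)%VS fullv.
  have imT X : exists2 A, A \in W & X = T *m A *m T ^t*.
    have /memv_imgP[A AW ->] : X \in (conjugation T @: W)%VS by rewrite full memvf.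
    by exists A; rewrite ?conjugationE.
  have freeT : row_free T.
    apply: inj_row_free => v vT; have [A _ defA] := imT 1%:M.
    by rewrite -[v]mulmx1 defA !mulmxA vT !mul0mx.
  have [S uST _] := row_free_orthonormalize freeT.
  have unitS : S \in unitmx.
    by have := unitarymxP uST; rewrite -mulmxA => /mulmx1_unit[].
  exists (S *m T) => //; left; apply/eqP; rewrite eqEsubv subvf; apply/subvP => X _.
  have [A AW defA] := imT (invmx S *m X *m (invmx S) ^t*).
  suff -> : X = conjugation (S *m T) A by apply: memv_img.
  rewrite conjugationE adjointM !mulmxA -(mulmxA S) -(mulmxA S) -defA.
  by rewrite !mulmxA mulmxV // mul1mx -mulmxA -adjointM mulmxV // adjoint1 mulmx1.
pose W0 := (W :&: lker (conjugation T))%VS.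
have W0P A : A \in W0 -> A \in W /\ T *m A *m T ^t* = 0.
  by rewrite memv_cap memv_ker conjugationE => /andP[AW /eqP].
have adjW0 A : A \in W0 -> A ^t* \in W0.
  move=> /W0P[AW TAT]; rewrite memv_cap memv_ker conjugationE adjW //=.
  have := congr1 (fun Y => Y ^t*) TAT.
  by rewrite !adjointM trmxCK adjoint0 mulmxA => ->.
have rankW0 A : A \in W0 -> (\rank A <= 4 * k)%N.
  by move=> /W0P[AW TAT]; apply: (maximal_image_rank maxT).
have [l le_l [B uB BW0]] := small_rank_part_compression adjW0 rankW0.
pose U := (W :\: W0)%VS.
pose re (X : 'M[C]_n) := B *m (X + X ^t*) *m B ^t*.
pose im (X : 'M[C]_n) := B *m ('i *: (X - X ^t*)) *m B ^t*.
pose Hs := [seq re X | X <- vbasis U] ++ [seq im X | X <- vbasis U].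
have dimU : (\dim U <= k * k)%N.
  rewrite -(leq_add2l (\dim (W :&: W0))) dimv_cap_compl.
  rewrite -(limg_ker_dim (conjugation T) W) leq_add ?dimle //.
  by rewrite (capv_idPr (capvSl _ _)).
case: (@hermitian_family_scalar_compression k l Hs) => [H||Z uZ ZP].
- rewrite mem_cat => /orP[] /mapP[X _ ->]; rewrite !adjointM trmxCK mulmxA.
    by rewrite adjointD trmxCK addrC.
  by rewrite adjointZ adjointB conjCi trmxCK scaleNr -scalerN opprB.
- rewrite size_cat !size_map size_tuple addnn.
  have : (2 ^ (\dim U).*2 <= 2 ^ (2 * (k * k)))%N by rewrite leq_exp2l //; lia.
  by move/(leq_mul (leqnn k))/leq_trans; apply; lia.
exists (Z *m B); first exact: mul_unitarymx; right.
have scalarU X : X \in vbasis U -> conjugation (Z *m B) X \in <[1%:M : 'M[C]_k]>%VS.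
  move=> Xb; have inspan Y : Y \in Hs -> Z *m Y *m Z ^t* \in <[1%:M : 'M[C]_k]>%VS.
    by move=> /ZP[c ->]; rewrite -scalemx1 memvZ ?memv_line.
  have reX : re X \in Hs by rewrite mem_cat map_f.
  have imX : im X \in Hs by rewrite mem_cat [im X \in map im _]map_f ?orbT.
  have -> : conjugation (Z *m B) X
      = 2^-1 *: (Z *m re X *m Z ^t*) + (- 'i / 2) *: (Z *m im X *m Z ^t*).
    rewrite conjugationE /re /im adjointM.
    rewrite !(mulmxDr, mulmxDl, mulmxN, mulNmx, =^~ scalemxAr, =^~ scalemxAl).
    rewrite !mulmxA scalerA mulrAC mulNr -expr2 sqrCi opprK mul1r.
    rewrite -scalerDr addrACA subrr addr0 -mulr2n -scaler_nat scalerA.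
    by rewrite mulVf ?pnatr_eq0 // scale1r.
  by rewrite memvD ?memvZ ?inspan.
apply/subvP => _ /memv_imgP[A AW ->].
have : A \in (U + (W :&: W0))%VS by rewrite addv_diff_cap.
case/memv_addP => A1 A1U [A2]; rewrite memv_cap => /andP[_ /BW0 A20] ->.
rewrite linearD /= [conjugation _ A2]conjugationE adjointM.
have -> : Z *m B *m A2 *m (B ^t* *m Z ^t*) = 0.
  by rewrite mulmxA -(mulmxA Z) -(mulmxA Z) A20 mulmx0 mul0mx.
rewrite addr0 (coord_vbasis A1U) linear_sum memv_suml // => i _.
by rewrite linearZ memvZ // scalarU // mem_nth // size_tuple.
Qed.

End QuantumRamsey.

(** * The finite graph Ramsey theorem *)

Section RamseyGraphs.
Variables (T : finType) (e : rel T).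
Hypothesis e_sym : symmetric e.

(** Induction on [a + b]: the neighbours or the non-neighbours of a vertex [x] number at least half
    the bound, and [x] extends a set of the matching kind found there. The ambient set [A] allows a
    second application inside the result of a first. *)
Lemma ramsey_graph a b (A : {set T}) : (2 ^ (a + b) <= #|A|)%N ->
     (exists2 B : {set T}, B \subset A /\ #|B| = a
       & {in B &, forall x y, x != y -> e x y})
  \/ (exists2 B : {set T}, B \subset A /\ #|B| = b
       & {in B &, forall x y, x != y -> ~~ e x y}).
Proof.
have [s] := ubnP (a + b); elim: s => // s IH in a b A *; rewrite ltnS.
case: a => [|a]; first by left; exists set0; rewrite ?sub0set ?cards0 // => x; rewrite inE.
case: b => [|b]; first by right; exists set0; rewrite ?sub0set ?cards0 // => x; rewrite inE.
move=> le_s le_A.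
have /card_gt0P[x xA] : (0 < #|A|)%N by rewrite (leq_trans _ le_A) ?expn_gt0.
pose N := [set y in A :\ x | e x y]; pose N' := [set y in A :\ x | ~~ e x y].
have cardN : (#|A| = #|N| + #|N'| + 1)%N.
  rewrite (cardsD1 x) xA addnC -(cardsID [set y | e x y] (A :\ x)); congr (_ + _ + _)%N.
    by apply: eq_card => y; rewrite !inE.
  by apply: eq_card => y; rewrite !inE andbC.
have subN : N \subset A by apply/subsetP => y; rewrite !inE => /andP[/andP[]].
have subN' : N' \subset A by apply/subsetP => y; rewrite !inE => /andP[/andP[]].
rewrite cardN addSn expnS mul2n -addnn in le_A.
have [le_N|lt_N] := leqP (2 ^ (a + b.+1)) #|N|.
  have [] := IH a b.+1 N _ le_N; first by rewrite -addSn.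
    move=> [B [sB cB] eB]; left; exists (x |: B).
      rewrite subUset sub1set xA (subset_trans sB) // cardsU1 cB.
      case: (boolP (x \in B)) => // /(subsetP sB); rewrite !inE eqxx.
      by [].
    have xB y : y \in B -> e x y by move=> /(subsetP sB); rewrite inE => /andP[].
    move=> y z /setU1P[->|yB] /setU1P[->|zB]; rewrite ?eqxx // => ne.
    - exact: xB.
    - by rewrite e_sym xB.
    - exact: eB.
  by move=> [B [sB cB] eB]; right; exists B => //; rewrite (subset_trans sB).
have le_N' : (2 ^ (a.+1 + b) <= #|N'|)%N.
  rewrite addSnnS; move: le_A lt_N.
  set n2 := (2 ^ _)%N; lia.
have [] := IH a.+1 b N' _ le_N'; first by rewrite -addnS.
  by move=> [B [sB cB] eB]; left; exists B => //; rewrite (subset_trans sB).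
move=> [B [sB cB] eB]; right; exists (x |: B).
  rewrite subUset sub1set xA (subset_trans sB) // cardsU1 cB.
  by case: (boolP (x \in B)) => // /(subsetP sB); rewrite !inE eqxx.
have xB y : y \in B -> ~~ e x y by move=> /(subsetP sB); rewrite inE => /andP[].
move=> y z /setU1P[->|yB] /setU1P[->|zB]; rewrite ?eqxx // => ne.
- exact: xB.
- by rewrite e_sym xB.
- exact: eB.
Qed.

End RamseyGraphs.

(** * Minimal projections and the commutant *)

Section StarAlgebra.
Variables (C : numClosedFieldType) (n : nat) (M : {vspace 'M[C]_n}).
Hypothesis M1 : 1%:M \in M.
Hypothesis MM : forall A B, A \in M -> B \in M -> A *m B \in M.
Hypothesis Madj : forall A, A \in M -> A ^t* \in M.

(** Membership in the commutant as a predicate, which makes sense for any size [n], zero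
    included. *)
Definition commutes_with (A : 'M[C]_n) := forall D, D \in M -> A *m D = D *m A.

(** The last clause is minimality in usable form: the corner of [M] at [p] is one-dimensional. *)
Definition minimal_projection (p : 'M[C]_n) :=
  [/\ p \in M, p != 0, p *m p = p, p ^t* = p
    & forall D, D \in M -> exists c, p *m D *m p = c *: p].

Lemma mxtrace_adjoint (A : 'M[C]_n) : \tr (A ^t*) = (\tr A)^*.
Proof. by rewrite trace_map_mx mxtrace_tr. Qed.

Lemma mxvec_inner (A B : 'M[C]_n) :
  (mxvec A *m (mxvec B) ^t*) 0 0 = \tr (A *m B ^t*).
Proof.
rewrite mxE /mxtrace (reindex _ (curry_mxvec_bij _ _)) /=.
rewrite (eq_bigr (fun ij => A ij.1 ij.2 * (B ij.1 ij.2)^*)); last first.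
  by case=> i j _; rewrite !mxE !mxvecE.
rewrite -(pair_bigA _ (fun i j => A i j * (B i j)^*)) /=.
by apply: eq_bigr => i _; rewrite mxE; apply: eq_bigr => j _; rewrite !mxE.
Qed.

(** Gram-Schmidt on a vectorized basis of [M]; orthonormality is recorded as the expansion
    formula. *)
Lemma frobenius_basis : exists2 b : 'I_(\dim M) -> 'M[C]_n,
  forall i, b i \in M & forall A, A \in M -> A = \sum_i \tr (A *m (b i) ^t*) *: b i.
Proof.
pose G := \matrix_i mxvec (tnth (vbasis M) i).
have : row_free G by rewrite row_free_mxvec (basis_free (vbasisP M)).
case/row_free_orthonormalize => S /unitarymxP uB eqB; set B := S *m G in uB eqB.
pose b i := vec_mx (row i B); exists b => [i | A AM].
  rewrite /b /B row_mul mulmx_sum_row linear_sum memv_suml // => j _.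
  by rewrite linearZ memvZ //= rowK mxvecK vbasis_mem ?mem_tnth.
have /submxP[w defA] : (mxvec A <= B)%MS.
  rewrite eqB (coord_vbasis AM) linear_sum summx_sub // => i _.
  rewrite linearZ scalemx_sub //=.
  rewrite [X in (X <= _)%MS](_ : _ = row i G) ?row_sub //.
  by rewrite rowK (tnth_nth 0).
have defw i : w 0 i = \tr (A *m (b i) ^t*).
  rewrite -mxvec_inner vec_mxK defA -(mulmxA w) rowE adjointM (mulmxA B) uB mul1mx.
  by rewrite trmx_delta map_delta_mx -colE mxE.
rewrite -[LHS]mxvecK defA mulmx_sum_row linear_sum; apply: eq_bigr => i _.
by rewrite linearZ defw.
Qed.

(* [X |-> \sum_i b_i X b_i^*], for [b] a Frobenius-orthonormal basis of [M],
   takes its values in the commutant of [M]; on the corner of a minimal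
   projection it acts as a positive scalar. *)
Lemma commutant_lift p X : minimal_projection p ->
  exists A, [/\ commutes_with A, p *m A *m p = p *m X *m p
    & forall q : 'M_n, (forall D, D \in M -> q *m D *m p = 0) -> q *m A = 0].
Proof.
move=> [pM p0 pp padj pmin]; have [b bM bE] := frobenius_basis.
have avg_comm Z : commutes_with (\sum_i b i *m Z *m (b i) ^t*).
  move=> D DM; rewrite mulmx_suml mulmx_sumr.
  (* The coefficient matrices of [left_mul] and [right_mul] are transposes of each other, so the two
     double sums agree after exchanging indices. *)
  have left_mul i : D *m b i = \sum_j \tr (D *m b i *m (b j) ^t*) *: b j.
    exact/bE/MM.
  have right_mul i : (b i) ^t* *m D = \sum_j \tr (D *m b j *m (b i) ^t*) *: (b j) ^t*.
    have := congr1 (fun Y => Y ^t*) (bE _ (MM (Madj DM) (bM i))).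
    rewrite adjointM trmxCK => ->; rewrite adjoint_sum; apply: eq_bigr => j _.
    rewrite adjointZ -mxtrace_adjoint !adjointM !trmxCK mulmxA.
    by rewrite mxtrace_mulC mulmxA.
  transitivity (\sum_i \sum_j \tr (D *m b j *m (b i) ^t*) *: (b i *m Z *m (b j) ^t*)).
    apply: eq_bigr => i _; rewrite -mulmxA right_mul mulmx_sumr.
    by apply: eq_bigr => j _; rewrite scalemxAr.
  rewrite exchange_big; apply: eq_bigr => i _ /=.
  rewrite !mulmxA [in RHS]left_mul !mulmx_suml; apply: eq_bigr => j _.
  by rewrite -!scalemxAl.
pose Z := p *m X *m p; pose F := \sum_i b i *m Z *m (b i) ^t*.
have [c cE] := choice (fun i => pmin (b i) (bM i)).
pose g := \sum_i c i * (c i)^*.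
(* [g] is the sum of the squared moduli of the [c i]; if it vanished, expanding the middle factor of
   [p *m p *m p] in [b] would give [p = 0]. *)
have g0 : g != 0.
  apply: contra_neq p0 => /eqP; rewrite psumr_eq0 => [/allP c0|i _]; last exact: mul_conjC_ge0.
  transitivity (p *m p *m p); first by rewrite !pp.
  rewrite {2}(bE p pM) mulmx_sumr mulmx_suml big1 // => i _.
  have := c0 i (mem_index_enum _); rewrite mul_conjC_eq0 => /eqP ci0.
  by rewrite -scalemxAr -scalemxAl cE ci0 scale0r scaler0.
have pFp : p *m F *m p = g *: Z.
  rewrite mulmx_sumr mulmx_suml scaler_suml; apply: eq_bigr => i _.
  have cE' : p *m (b i) ^t* *m p = (c i)^* *: p.
    by have := congr1 (fun Y => Y ^t*) (cE i); rewrite !adjointM adjointZ padj mulmxA.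
  transitivity ((p *m b i *m p) *m X *m (p *m (b i) ^t* *m p)).
    by rewrite /Z !mulmxA.
  by rewrite cE cE' -!scalemxAl -!scalemxAr scalerA.
exists (g^-1 *: F); split=> [D DM||q q0].
- by rewrite -scalemxAl -scalemxAr avg_comm.
- by rewrite -scalemxAr -scalemxAl pFp scalerA mulVf ?scale1r.
rewrite -scalemxAr mulmx_sumr big1 ?scaler0 // => i _.
by rewrite /Z !mulmxA q0 // !mul0mx.
Qed.

(** Acting on the row space of [A], [X] has an eigenvector there because the field is algebraically
    closed; subtracting its eigenvalue puts that vector in the kernel. *)
Lemma rank_drop_eigenvalue (A X : 'M[C]_n) : A != 0 -> (A *m X <= A)%MS ->
  exists c, (\rank (A *m (X - c%:M))%R < \rank A)%N.
Proof.
move=> A0 stabA.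
have /submxP[X' defX'] : (row_base A *m X <= row_base A)%MS.
  by rewrite eq_row_base (submx_trans _ stabA) // submxMr // eq_row_base.
have [|c /eigenvalueP[v vX' v0]] := eigenvalue_closed X'.
  by rewrite lt0n mxrank_eq0.
exists c; rewrite -[X in (_ < X)%N](mxrank_mul_ker A (X - c%:M)).
rewrite -addn1 leq_add2l lt0n mxrank_eq0.
apply: contra_neq v0 => cap0; apply: (row_free_inj (row_base_free A)).
rewrite mul0mx; apply/eqP; rewrite -submx0 -cap0 sub_capmx.
rewrite (submx_trans (submxMl _ _)) ?eq_row_base //=; apply/sub_kermxP.
by rewrite mulmxBr -mulmxA defX' mulmxA vX' mul_mx_scalar -scalemxAl subrr.
Qed.

(** Take [X] nonzero of minimal rank in the corner of [M] at [e], and [Y = X *m X ^t*]. By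
    [rank_drop_eigenvalue], [Y *m (Y - c%:M)] has smaller rank, so it vanishes and [c^-1 *: Y] is a
    projection; the same argument in its own corner gives minimality. *)
Lemma exists_minimal_projection e :
    e \in M -> e != 0 -> e *m e = e -> e ^t* = e ->
  exists2 p, minimal_projection p & e *m p = p.
Proof.
move=> eM e0 ee eadj.
pose corner X := [/\ X \in M, e *m X *m e = X & X != 0].
have [|X [XM eXe X0] minX] := @exists_minimizer _ corner (fun X => \rank X).
  by exists e; rewrite /corner !ee.
have small Z : Z \in M -> e *m Z *m e = Z -> (\rank Z < \rank X)%N -> Z = 0.
  move=> ZM eZe; rewrite ltnNge => lt; apply/eqP; apply: contraNT lt => Z0.
  exact: minX.
have eX : e *m X = X by rewrite -eXe !mulmxA ee.
pose Y := X *m X ^t*.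
have YM : Y \in M by rewrite MM ?Madj.
have Y0 : Y != 0 by rewrite mulmx_adjoint_eq0.
have Yadj : Y ^t* = Y by rewrite adjointM trmxCK.
have eY : e *m Y = Y by rewrite mulmxA eX.
have Ye : Y *m e = Y by rewrite -{1}Yadj -{1}eadj -adjointM eY.
have [c rkc] := rank_drop_eigenvalue Y0 (submxMl Y Y).
have YY : Y *m Y = c *: Y.
  apply/eqP; rewrite -subr_eq0 -mul_mx_scalar -mulmxBr; apply/eqP/small.
  - by rewrite mulmxBr mul_mx_scalar rpredB ?memvZ ?MM ?Madj.
  - by rewrite mulmxA eY mulmxBr mulmxBl -mulmxA Ye mul_mx_scalar -scalemxAl Ye.
  - by apply: leq_trans rkc _; apply: mxrankM_maxl.
have c0 : c != 0.
  apply: contra_neq Y0 => c0; apply/eqP.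
  by rewrite -mulmx_adjoint_eq0 Yadj YY c0 scale0r.
have creal : c^* = c.
  have := congr1 (fun Z => Z ^t*) YY; rewrite adjointM adjointZ Yadj YY.
  move=> /eqP; rewrite -subr_eq0 -scalerBl scaler_eq0 (negPf Y0) orbF subr_eq0.
  by move/eqP.
pose p := c^-1 *: Y.
have pM : p \in M by rewrite memvZ.
have p0 : p != 0 by rewrite scaler_eq0 invr_eq0 negb_or c0.
have pp : p *m p = p.
  by rewrite -scalemxAl -scalemxAr YY !scalerA divfK.
have ep : e *m p = p by rewrite -scalemxAr eY.
have pe : p *m e = p by rewrite -scalemxAl Ye.
exists p => //; split=> // [|D DM].
  by rewrite adjointZ Yadj fmorphV /= creal.
have [d rkd] : exists d, (\rank (p *m (p *m D *m p - d%:M))%R < \rank p)%N.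
  by apply: rank_drop_eigenvalue => //; rewrite mulmxA submxMl.
exists d; apply/eqP; rewrite -subr_eq0; apply/eqP/small.
- by rewrite rpredB ?memvZ ?MM ?Madj.
- rewrite mulmxBr mulmxBl -(scalemxAr d e p) -(scalemxAl d _ e) !mulmxA !ep pe.
  by rewrite -[_ *m p *m e]mulmxA pe.
rewrite mulmxBr mul_mx_scalar !mulmxA pp in rkd.
apply: leq_trans rkd _; apply: leq_trans (mxrankM_maxl X (X ^t*)).
by rewrite -/Y mxrank_scale_nz ?invr_eq0.
Qed.

End StarAlgebra.

(** * Bimodules over the commutant *)

Section OperatorBimodule.
Variables (C : numClosedFieldType) (n : nat) (M V : {vspace 'M[C]_n}).
Hypothesis M1 : 1%:M \in M.
Hypothesis MM : forall A B, A \in M -> B \in M -> A *m B \in M.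
Hypothesis Madj : forall A, A \in M -> A ^t* \in M.
Hypothesis V1 : 1%:M \in V.
Hypothesis Vadj : forall A, A \in V -> A ^t* \in V.
Hypothesis Vbimod : forall A X B,
  commutes_with M A -> X \in V -> commutes_with M B -> A *m X *m B \in V.

(** Only the nontrivial inclusions of the two outcomes; the reverse ones follow from [subvf] and
    from the commutant lying in [V]. *)
Definition homogeneous (P : 'M[C]_n) :=
  (conjugation P @: fullv <= conjugation P @: V)%VS \/
  forall Y, Y \in V -> exists2 A, commutes_with M A & P *m Y *m P = P *m A *m P.

Lemma unit_row (p : 'M[C]_n) : p != 0 -> p *m p = p ->
  exists2 e : 'rV_n, e *m p = e & e *m e ^t* = 1%:M.
Proof.
move=> p0 pp.
have [i pi0] : exists i, row i p != 0.
  apply/existsP; apply: contra_neqT p0 => /existsPn rows0.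
  by apply/row_matrixP => i; rewrite row0; apply/eqP; rewrite -[_ == _]negbK rows0.
have [|B /unitarymxP uB _] := @row_free_orthonormalize C _ _ (row i p).
  by rewrite /row_free rank_rV pi0.
by exists (B *m row i p) => //; rewrite -mulmxA -row_mul pp.
Qed.

Lemma rank_of_unitary_rows k (F : 'M[C]_(k, n)) (P : 'M_n) :
  F \is unitarymx -> F *m P = F -> (k <= \rank P)%N.
Proof. by move=> uF FP; rewrite -(mxrank_unitary uF) -FP mxrankM_maxr. Qed.

(** Greedy construction: the sum of the projections found so far has rank below [n], so its
    complement is a nonzero projection of [M] and contains a further minimal one. *)
Lemma minimal_projection_family k r :
    (0 < k)%N -> (forall p, minimal_projection M p -> (\rank p < k)%N) ->
    (r * k <= n)%N ->
  exists2 f : nat -> 'M[C]_n, (forall i, (i < r)%N -> minimal_projection M (f i))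
    & forall i j, (i < r)%N -> (j < r)%N -> i != j -> f i *m f j = 0.
Proof.
move=> k0 small; elim: r => [|r IH] le_rk; first by exists (fun=> 0).
have [|f fmin forth] := IH; first by rewrite mulSn in le_rk; lia.
pose J := \sum_(i < r) f i; pose e := 1%:M - J.
have fadj i : (i < r)%N -> (f i) ^t* = f i by case/fmin.
have fJ i : (i < r)%N -> f i *m J = f i.
  move=> lt_i; have [_ _ ff _ _] := fmin i lt_i.
  rewrite mulmx_sumr (bigD1 (Ordinal lt_i)) //= ff big1 ?addr0 // => j ne.
  by rewrite forth // eq_sym.
have Jadj : J ^t* = J.
  by rewrite adjoint_sum; apply: eq_bigr => i _; rewrite fadj.
have JJ : J *m J = J.
  by rewrite {1}/J mulmx_suml; apply: eq_bigr => i _; rewrite fJ.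
have JM : J \in M by apply: memv_suml => i _; case: (fmin i (ltn_ord i)).
have rankJ : (\rank J <= r * k.-1)%N.
  have rank_sum s : (s <= r)%N -> (\rank (\sum_(i < s) f i)%R <= s * k.-1)%N.
    elim: s => [|s IHs] lt_s; first by rewrite big_ord0 mxrank0.
    rewrite big_ord_recr /= (leq_trans (mxrank_add _ _)) // mulSn addnC leq_add //.
      by have := small _ (fmin s lt_s); lia.
    by rewrite IHs // ltnW.
  exact: rank_sum.
have eM : e \in M by rewrite memvB.
have e0 : e != 0.
  rewrite subr_eq0; apply: contraTneq rankJ => <-; rewrite mxrank1 -ltnNge.
  by apply: leq_trans le_rk; nia.
have ee : e *m e = e by rewrite mulmxBl mul1mx mulmxBr mulmx1 JJ subrr subr0.
have eadj : e ^t* = e.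
  by rewrite /e adjointB adjoint1 Jadj.
have [p pmin ep] := exists_minimal_projection MM Madj eM e0 ee eadj.
have [_ _ _ padj _] := pmin.
have fp i : (i < r)%N -> f i *m p = 0.
  by move=> lt_i; rewrite -ep mulmxA mulmxBr mulmx1 fJ // subrr mul0mx.
have pf i : (i < r)%N -> p *m f i = 0.
  move=> lt_i; have := congr1 (fun Y => Y ^t*) (fp i lt_i).
  by rewrite adjointM padj fadj // adjoint0.
exists (fun i => if (i < r)%N then f i else p) => [i _|i j].
  by case: ifP => // /fmin.
rewrite !ltnS => le_i le_j; case: ltnP => ri; case: ltnP => rj ne.
- exact: forth.
- exact: fp.
- exact: pf.
- by case/eqP: ne; apply/eqP; rewrite eqn_leq; lia.
Qed.

Lemma commutesV A : commutes_with M A -> A \in V.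
Proof.
move=> cA; rewrite -[A]mulmx1 -[A *m _]mulmx1; apply: Vbimod => // D _.
by rewrite mul1mx mulmx1.
Qed.

(** [commutant_lift] realizes every [p *m X *m p] by an element of the commutant, hence of [V]. *)
Lemma homogeneous_minimal p : minimal_projection M p -> homogeneous p.
Proof.
move=> pmin; left; have [_ _ _ padj _] := pmin.
apply/subvP => _ /memv_imgP[X _ ->].
have [A [cA pAp _]] := commutant_lift MM Madj X pmin.
by rewrite !conjugationE padj -pAp -{2}padj -conjugationE memv_img ?commutesV.
Qed.

Lemma rank_one_sum (Z : 'M[C]_n) :
  Z = \sum_i (Z *m delta_mx i (0 : 'I_1)) *m delta_mx 0 i.
Proof.
rewrite -[LHS]mulmx1 [1%:M]matrix_sum_delta mulmx_sumr; apply: eq_bigr => i _.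
rewrite (bigD1 i) //= big1 ?addr0 => [|j ne].
  by rewrite mxE eqxx scale1r -mulmxA mul_delta_mx.
by rewrite mxE eq_sym (negPf ne) scale0r.
Qed.

(** [P] is the sum of the [f i]. Inequivalence lets an element of the commutant produce a single
    block [f i *m X *m f i] of [P]. So a nonzero block from [V] generates every block at its place,
    and if the off-diagonal blocks vanish, the diagonal ones come from the commutant. *)
Lemma homogeneous_inequivalent k (f : 'I_k -> 'M[C]_n) :
    (forall i, minimal_projection M (f i)) ->
    (forall i j, i != j -> f i *m f j = 0) ->
    (forall i j, i != j -> forall D, D \in M -> f i *m D *m f j = 0) ->
    (forall i j, i != j -> exists2 Y, Y \in V & f i *m Y *m f j != 0) \/
    (forall i j, i != j -> forall Y, Y \in V -> f i *m Y *m f j = 0) ->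
  exists P, [/\ P \in M, P *m P = P, P ^t* = P, (k <= \rank P)%N & homogeneous P].
Proof.
move=> fmin forth fineq homV; have [P defP] : {P | P = \sum_i f i} by exists (\sum_i f i).
have fM i : f i \in M by case: (fmin i).
have ff i : f i *m f i = f i by case: (fmin i).
have fadj i : (f i) ^t* = f i by case: (fmin i).
have fP i : f i *m P = f i.
  by rewrite defP mulmx_sumr (bigD1 i) //= ff big1 ?addr0 // => j ne; rewrite forth // eq_sym.
have Pf i : P *m f i = f i.
  by rewrite defP mulmx_suml (bigD1 i) //= ff big1 ?addr0 // => j ne; rewrite forth.
have Padj : P ^t* = P by rewrite defP adjoint_sum; apply: eq_bigr.
have lift i X : exists A, [/\ commutes_with M A, P *m A = f i *m X *m f i
    & A *m P = f i *m X *m f i].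
  have [A [cA fAf A0]] := commutant_lift MM Madj X (fmin i).
  have PA : P *m A = f i *m X *m f i.
    rewrite defP mulmx_suml (bigD1 i) //= big1 ?addr0 => [|j ne].
      by rewrite -{1}ff -mulmxA -cA // mulmxA.
    by apply: A0 => D DM; apply: fineq.
  by exists A; split=> //; rewrite cA // defP memv_suml.
have /choice[e eP] i : exists e : 'rV[C]_n, e *m f i = e /\ e *m e ^t* = 1%:M.
  have [_ p0 pp _ _] := fmin i.
  by have [e ? ?] := unit_row p0 pp; exists e.
pose F := \matrix_i e i.
have FP : F *m P = F.
  apply/row_matrixP => i; rewrite row_mul rowK.
  by have [<- _] := eP i; rewrite -mulmxA fP.
have uF : F \is unitarymx.
  apply/row_unitarymxP => i j; rewrite dotmxE !rowK.
  have [<-|ne] := eqVneq i j; first by have [_ ->] := eP i; rewrite mxE.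
  have [<- _] := eP i; have [<- _] := eP j.
  rewrite adjointM fadj mulmxA -(mulmxA (e i)) forth // mulmx0 mul0mx mxE.
  by [].
exists P; split=> //.
- by rewrite defP memv_suml.
- by rewrite {1}defP mulmx_suml [RHS]defP; apply: eq_bigr => i _; rewrite fP.
- exact: rank_of_unitary_rows uF FP.
case: homV => [clique|anti]; [left | right].
  have fXf i j X : f i *m X *m f j \in (conjugation P @: V)%VS.
    have [Y YV Y0] : exists2 Y, Y \in V & f i *m Y *m f j != 0.
      have [<-|] := eqVneq i j; last exact: clique.
      by exists 1%:M; rewrite // mulmx1 ff; case: (fmin i).
    have /matrix0Pn[a [b ab]] := Y0.
    set c := _ a b in ab.
    have rank_one (x : 'cV_n) (y : 'rV_n) :
        f i *m (x *m y) *m f j \in (conjugation P @: V)%VS.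
      (* [A] and [B] pick out the nonzero entry [c] at [(a, b)] and attach [x] and [y] to it. *)
      have [A [cA PA _]] := lift i (x *m (delta_mx 0 a : 'rV_n)).
      have [B [cB _ BP]] := lift j ((delta_mx b 0 : 'cV_n) *m y).
      have : conjugation P (A *m Y *m B) \in (conjugation P @: V)%VS.
        by rewrite memv_img // Vbimod.
      rewrite conjugationE Padj.
      have -> : P *m (A *m Y *m B) *m P = (P *m A) *m Y *m (B *m P).
        by rewrite !mulmxA.
      have -> : P *m A *m Y *m (B *m P) = c *: (f i *m (x *m y) *m f j).
        rewrite PA BP.
        transitivity (f i *m x *m
          (delta_mx 0 a *m (f i *m Y *m f j) *m delta_mx b 0) *m y *m f j).
          by rewrite !mulmxA.
        rewrite [delta_mx 0 a *m _ *m _]mx11_scalar -rowE -colE.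
        rewrite [X in X%:M](_ : _ = c); last by rewrite [LHS]mxE [LHS]mxE.
        by rewrite mul_mx_scalar -!scalemxAl !mulmxA.
      by move/(memvZ c^-1); rewrite scalerA mulVf ?scale1r.
    rewrite [X]rank_one_sum mulmx_sumr mulmx_suml memv_suml // => l _.
  apply/subvP => _ /memv_imgP[X _ ->]; rewrite conjugationE Padj.
  rewrite {1}defP !mulmx_suml memv_suml // => i _.
  by rewrite [X in _ *m X]defP mulmx_sumr memv_suml.
move=> Y YV.
have [A AP] := choice (fun i => lift i Y).
exists (\sum_i A i) => [D DM|].
  by rewrite mulmx_suml mulmx_sumr; apply: eq_bigr => i _; have [cA _ _] := AP i; apply: cA.
transitivity (\sum_i f i *m Y *m f i); last first.
  rewrite mulmx_sumr mulmx_suml; apply: eq_bigr => i _.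
  by have [_ -> _] := AP i; rewrite -[RHS]mulmxA fP.
rewrite {1}defP !mulmx_suml; apply: eq_bigr => i _.
rewrite defP mulmx_sumr (bigD1 i) //= big1 ?addr0 // => j ne.
by rewrite anti // eq_sym.
Qed.

(** The [(t a) ^t* *m t a] are orthogonal projections with sum [P], so [P *m X *m P] is a [k] by [k]
    matrix of blocks in the corner of [p]. Commutant elements multiply all blocks by one corner
    matrix, which may be prescribed, so the scalars seen by [e] decide: matrix units generate every
    block matrix, scalar matrices force the commutant. *)
Lemma homogeneous_frame k p (e : 'rV[C]_n) (t : 'I_k -> 'M[C]_n) :
    (0 < k)%N -> minimal_projection M p -> e *m p = e -> e *m e ^t* = 1%:M ->
    (forall a, t a \in M) -> (forall a, p *m t a = t a) ->
    (forall a b, t a *m (t b) ^t* = p *+ (a == b)) ->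
    (forall a b, exists2 Y, Y \in V & forall c d,
       e *m (t c *m Y *m (t d) ^t*) *m e ^t* = ((c == a) && (d == b))%:R%:M) \/
    (forall Y, Y \in V -> exists x, forall a b,
       e *m (t a *m Y *m (t b) ^t*) *m e ^t* = (x *+ (a == b))%:M) ->
  exists P, [/\ P \in M, P *m P = P, P ^t* = P, (k <= \rank P)%N & homogeneous P].
Proof.
move=> k0 pmin ep ee tM pt tt dich; have [_ _ pp padj _] := pmin.
have [P defP] : {P | P = \sum_a (t a) ^t* *m t a} by exists (\sum_a (t a) ^t* *m t a).
have tP a : t a *m P = t a.
  rewrite defP mulmx_sumr (bigD1 a) //= mulmxA tt eqxx pt big1 ?addr0 // => b ne.
  by rewrite mulmxA tt eq_sym (negPf ne) mul0mx.
have Padj : P ^t* = P.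
  by rewrite defP adjoint_sum; apply: eq_bigr => a _; rewrite adjointM trmxCK.
have Pt a : P *m (t a) ^t* = (t a) ^t*.
  by rewrite -{1}Padj -adjointM tP.
have PP : P *m P = P.
  rewrite {1}defP mulmx_suml [RHS]defP; apply: eq_bigr => a _.
  by rewrite -mulmxA tP.
have PXP X : P *m X *m P = \sum_a \sum_b (t a) ^t* *m (t a *m X *m (t b) ^t*) *m t b.
  rewrite {1}defP !mulmx_suml; apply: eq_bigr => a _.
  rewrite [X in _ *m X]defP mulmx_sumr; apply: eq_bigr => b _.
  by rewrite !mulmxA.
have pM : p \in M by case: pmin.
have pe : p *m e ^t* = e ^t* by rewrite -padj -adjointM ep.
have tp a : (t a) ^t* *m p = (t a) ^t* by rewrite -{1}padj -adjointM pt.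
have lift X : exists2 A, commutes_with M A & A *m p = p *m X *m p.
  have [A [cA pAp _]] := commutant_lift MM Madj X pmin.
  by exists A => //; rewrite -{1}pp mulmxA cA ?pAp.
have sandwich A B Y c d : commutes_with M A -> commutes_with M B ->
    t c *m (A *m Y *m B) *m (t d) ^t*
    = (A *m p) *m (t c *m Y *m (t d) ^t*) *m (B *m p).
  move=> cA cB; rewrite (cB p pM).
  transitivity ((t c *m A) *m Y *m (B *m (t d) ^t*)); first by rewrite !mulmxA.
  by rewrite -(cA _ (tM c)) (cB _ (Madj (tM d))) -{1}(pt c) -{1}(tp d) !mulmxA.
pose F := \matrix_a (e *m t a).
have FP : F *m P = F.
  by apply/row_matrixP => a; rewrite row_mul rowK -mulmxA tP.
have uF : F \is unitarymx.
  apply/row_unitarymxP => a b; rewrite dotmxE !rowK adjointM mulmxA -(mulmxA e) tt.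
  by case: eqP => _; rewrite ?mulr1n ?mulr0n ?ep ?ee ?mulmx0 ?mul0mx !mxE.
exists P; split=> //.
- by rewrite defP memv_suml // => a _; rewrite MM ?Madj.
- exact: rank_of_unitary_rows uF FP.
case: dich => [clique|anti]; [left | right].
  have tXt a b X : (t a) ^t* *m (p *m X *m p) *m t b \in (conjugation P @: V)%VS.
    have [Y YV Ycd] := clique a b.
    have rank_one (x : 'cV_n) (y : 'rV_n) :
        (t a) ^t* *m (p *m (x *m y) *m p) *m t b \in (conjugation P @: V)%VS.
      (* [A] and [B] turn the pattern of [Y], a single 1 at [(a, b)], into the block of [x *m y] at
         that place. *)
      have [A cA Ap] := lift (x *m e).
      have [B cB Bp] := lift (e ^t* *m y).
      suff <- : conjugation P (A *m Y *m B) = (t a) ^t* *m (p *m (x *m y) *m p) *m t b.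
        by rewrite memv_img // Vbimod.
      have term c d : (t c) ^t* *m (t c *m (A *m Y *m B) *m (t d) ^t*) *m t d
          = ((c == a) && (d == b))%:R *: ((t c) ^t* *m (p *m (x *m y) *m p) *m t d).
        rewrite sandwich //.
        rewrite Ap Bp.
        have -> : p *m (x *m e) *m p *m (t c *m Y *m (t d) ^t*)
              *m (p *m (e ^t* *m y) *m p)
            = p *m x *m (e *m (t c *m Y *m (t d) ^t*) *m e ^t*) *m y *m p.
          by rewrite !mulmxA -(mulmxA _ e p) ep -(mulmxA _ p (e ^t*)) pe.
        by rewrite Ycd mul_mx_scalar -!scalemxAl -!scalemxAr -scalemxAl !mulmxA.
      rewrite conjugationE Padj PXP (bigD1 a) //= (bigD1 b) //= term !eqxx scale1r.
      rewrite big1 => [|d ne]; last by rewrite term (negPf ne) andbF scale0r.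
      rewrite addr0 big1 ?addr0 // => c ne; rewrite big1 // => d _.
      by rewrite term (negPf ne) scale0r.
    rewrite [X]rank_one_sum mulmx_sumr !mulmx_suml mulmx_sumr mulmx_suml.
    by rewrite memv_suml.
  apply/subvP => _ /memv_imgP[X _ ->]; rewrite conjugationE Padj PXP.
  apply: memv_suml => a _; apply: memv_suml => b _.
  suff -> : t a *m X *m (t b) ^t* = p *m (t a *m X *m (t b) ^t*) *m p by apply: tXt.
  by rewrite !mulmxA pt -[RHS]mulmxA -[X in _ *m (_ *m X)]padj -adjointM pt.
move=> Y YV.
pose a0 := Ordinal k0; pose Z := t a0 *m Y *m (t a0) ^t*.
have blocks a b : t a *m Y *m (t b) ^t* = Z *+ (a == b).
  have pGp c d : p *m (t c *m Y *m (t d) ^t*) *m p = t c *m Y *m (t d) ^t*.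
    by rewrite !mulmxA pt -[LHS]mulmxA -[X in _ *m (_ *m X)]padj -adjointM pt.
  apply/matrixP => i j.
  (* [A] and [B] move entry [(i, j)] of every block to the place seen by [e], where [anti] applies
     because the product stays in [V]. *)
  have [A cA Ap] := lift (e ^t* *m (delta_mx 0 i : 'rV_n)).
  have [B cB Bp] := lift ((delta_mx j 0 : 'cV_n) *m e).
  have [x xE] := anti _ (Vbimod cA YV cB).
  have entry c d : (t c *m Y *m (t d) ^t*) i j = x *+ (c == d).
    have := xE c d.
    have -> : e *m (t c *m (A *m Y *m B) *m (t d) ^t*) *m e ^t*
        = delta_mx 0 i *m (t c *m Y *m (t d) ^t*) *m delta_mx j 0.
      rewrite sandwich // Ap Bp !mulmxA ep ee mul1mx.
      rewrite -(mulmxA _ e p) ep -(mulmxA _ e (e ^t*)) ee mulmx1.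
      by rewrite -(mulmxA _ p (t c)) pt -(mulmxA _ ((t d) ^t*) p) tp.
    rewrite -rowE -colE => /matrixP/(_ 0 0); rewrite [LHS]mxE [LHS]mxE => ->.
    by rewrite mxE eqxx mulr1n.
  rewrite entry; case: (a == b); last by rewrite mulr0n mxE.
  by rewrite !mulr1n /Z entry eqxx.
(* [Z] lies in the corner of [p], so [A *m p = Z] and [A] has the same blocks as [Y]. *)
have [A cA Ap] := lift Z.
exists A => //; rewrite !PXP; apply: eq_bigr => a _; apply: eq_bigr => b _.
congr (_ *m _ *m _); rewrite blocks -cA //.
rewrite -mulmxA tt; case: (a == b); last by rewrite !mulr0n mulmx0.
rewrite !mulr1n Ap /Z !mulmxA pt -[RHS]mulmxA -[X in _ *m (_ *m X)]padj -adjointM pt.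
by [].
Qed.

(** The rows [e *m u i] compress [V] to a self-adjoint space of [r] by [r] matrices. The [T] that
    [quantum_ramsey] gives for it combines the [u i] into the frame for [homogeneous_frame]. *)
Lemma homogeneous_equivalent k r p (u : 'I_r -> 'M[C]_n) :
    (0 < k)%N -> (k * 2 ^ (2 * (k * k)) + 8 * k <= r)%N ->
    minimal_projection M p -> (forall i, u i \in M) ->
    (forall i j, u i *m (u j) ^t* = p *+ (i == j)) ->
  exists P, [/\ P \in M, P *m P = P, P ^t* = P, (k <= \rank P)%N & homogeneous P].
Proof.
move=> k0 le_r pmin uM uu; have [_ p0 pp padj _] := pmin.
have pu i : p *m u i = u i.
  apply/eqP; rewrite -subr_eq0 -mulmx_adjoint_eq0.
  rewrite adjointB adjointM padj.
  rewrite mulmxBl !mulmxBr !mulmxA -!(mulmxA p (u i)) !uu eqxx mulr1n !pp.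
  by rewrite !subrr.
have [e ep ee] := unit_row p0 pp.
pose E := \matrix_i (e *m u i).
have [B|T uT dich] := @quantum_ramsey C k r (conjugation E @: V) le_r.
  move=> /memv_imgP[Y YV ->]; rewrite conjugationE !adjointM trmxCK mulmxA.
  by rewrite -conjugationE memv_img ?Vadj.
pose t a := \sum_i T a i *: u i.
have form Y a b : e *m (t a *m Y *m (t b) ^t*) *m e ^t*
    = ((conjugation T (conjugation E Y)) a b)%:M.
  have et c : e *m t c = delta_mx 0 c *m (T *m E).
    rewrite -rowE row_mul [RHS]mulmx_sum_row mulmx_sumr; apply: eq_bigr => i _.
    by rewrite rowK mxE scalemxAr.
  transitivity ((e *m t a) *m Y *m (e *m t b) ^t*).
    by rewrite adjointM !mulmxA.
  rewrite !et !conjugationE.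
  transitivity ((delta_mx 0 a : 'rV_k) *m (T *m (E *m Y *m E ^t*) *m T ^t*)
    *m delta_mx b (0 : 'I_1)).
    by rewrite !adjointM trmx_delta map_delta_mx !mulmxA.
  rewrite -rowE -colE [LHS]mx11_scalar; congr (_%:M).
  by rewrite [LHS]mxE [LHS]mxE.
apply: (homogeneous_frame (t := t) k0 pmin ep ee) => [a|a|a b|].
- by apply: memv_suml => i _; rewrite memvZ.
- by rewrite mulmx_sumr; apply: eq_bigr => i _; rewrite -scalemxAr pu.
- have -> : p *+ (a == b) = (T *m T ^t*) a b *: p.
    by rewrite (unitarymxP uT) mxE scaler_nat.
  rewrite mxE scaler_suml mulmx_suml; apply: eq_bigr => i _.
  rewrite adjoint_sum mulmx_sumr (bigD1 i) //= adjointZ -scalemxAl -scalemxAr uu.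
  rewrite eqxx scalerA !mxE big1 ?addr0 // => j ne.
  by rewrite adjointZ -scalemxAl -scalemxAr uu eq_sym (negPf ne) !scaler0.
case: dich => [full|/subvP scalar]; [left=> a b | right=> Y YV].
  have : delta_mx a b \in (conjugation T @: (conjugation E @: V))%VS.
    by rewrite full memvf.
  move=> /memv_imgP[_ /memv_imgP[Y YV ->] defd]; exists Y => // c d.
  by rewrite form -defd mxE.
have /vlineP[x xE] := scalar _ (memv_img (conjugation T) (memv_img (conjugation E) YV)).
by exists x => a b; rewrite form xE !mxE mulr_natr.
Qed.

(** A polar decomposition: for [x = p *m D *m q], minimality of [p] makes [x *m x ^t*] a positive
    multiple of [p], and normalizing [x] gives [u]. *)
Lemma partial_isometry p q D : minimal_projection M p -> minimal_projection M q ->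
    D \in M -> p *m D *m q != 0 ->
  exists u, [/\ u \in M, u *m u ^t* = p & u *m q = u].
Proof.
move=> [pM p0 pp padj pmin] [qM _ qq qadj _] DM; set x := p *m D *m q => x0.
have [c xx] : exists c, x *m x ^t* = c *: p.
  have [c cE] := pmin (D *m q *m D ^t*) (MM (MM DM qM) (Madj DM)).
  exists c; rewrite -cE /x !adjointM qadj padj.
  by rewrite -[LHS]mulmxA (mulmxA q q) qq !mulmxA.
have [e ep ee] := unit_row p0 pp.
have c0 : 0 <= c.
  have -> : c = ((e *m x) *m (e *m x) ^t*) 0 0.
    rewrite adjointM mulmxA -(mulmxA e) xx -scalemxAr ep -scalemxAl ee.
    by rewrite !mxE eqxx mulr1.
  rewrite mxE; apply: sumr_ge0 => i _; rewrite !mxE.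
  exact: mul_conjC_ge0.
have cn0 : c != 0.
  by apply: contra_neq x0 => c00; apply/eqP; rewrite -mulmx_adjoint_eq0 xx c00 scale0r.
exists ((sqrtC c)^-1 *: x); split.
- by rewrite memvZ ?MM.
- rewrite adjointZ -scalemxAl -scalemxAr xx !scalerA.
  have -> : ((sqrtC c)^-1)^* = (sqrtC c)^-1.
    by apply: geC0_conj; rewrite invr_ge0 sqrtC_ge0.
  by rewrite -invfM -expr2 sqrtCK mulVf ?scale1r.
- by rewrite -scalemxAl /x -(mulmxA _ q q) qq.
Qed.

(** The exponent asks for [N] linked or [2 ^ (k + k)] unlinked projections: [N] is the size needed
    by [homogeneous_equivalent], and the other number allows a second Ramsey step. The factor [k]
    makes room for [r] orthogonal minimal projections of rank below [k]. *)
Theorem bimodule_ramsey k :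
    (0 < k)%N ->
    (2 ^ (k * 2 ^ (2 * (k * k)) + 8 * k + 2 ^ (k + k)) * k <= n)%N ->
  exists P, [/\ P \in M, P *m P = P, P ^t* = P, (k <= \rank P)%N & homogeneous P].
Proof.
move=> k0; set N := (k * _ + _)%N; set r := (2 ^ _)%N => le_n.
have [[p pmin le_p]|small] := EM (exists2 p, minimal_projection M p & (k <= \rank p)%N).
  by exists p; have [pM _ pp padj _] := pmin; split=> //; apply: homogeneous_minimal.
have {}small p : minimal_projection M p -> (\rank p < k)%N.
  by move=> pmin; rewrite ltnNge; apply/negP => le_p; apply: small; exists p.
have [f' f'min f'orth] := minimal_projection_family k0 small le_n.
pose f (i : 'I_r) := f' i.
have fmin i : minimal_projection M (f i) by apply: f'min.
have forth i j : i != j -> f i *m f j = 0 by move=> ne; apply: f'orth.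
have fadj i : (f i) ^t* = f i by case: (fmin i).
(* For [W = M] this is equivalence of minimal projections; for [W = V] it is the graph seen by the
   operator system. *)
pose linked (W : {vspace 'M[C]_n}) : rel 'I_r :=
  fun i j => `[< exists2 D, D \in W & f i *m D *m f j != 0 >].
have linked_sym (W : {vspace 'M[C]_n}) : (forall A, A \in W -> A ^t* \in W) ->
    symmetric (linked W).
  move=> adjW; have half i j : linked W i j -> linked W j i.
    move=> /asboolP[D DW D0]; apply/asboolP; exists (D ^t*); first exact: adjW.
    apply: contra_neq D0 => fDf; have := congr1 (fun Y => Y ^t*) fDf.
    by rewrite !adjointM trmxCK !fadj adjoint0 mulmxA.
  by move=> i j; apply/idP/idP; apply: half.
have notlinked W i j : ~~ linked W i j -> forall D, D \in W -> f i *m D *m f j = 0.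
  move=> /asboolPn nl D DW; apply/eqP; apply: contraT => D0.
  by case: nl; exists D.
have [|[B [_ cB] clique]|[B [_ cB] anti]] :=
    @ramsey_graph _ _ (linked_sym M Madj) N (2 ^ (k + k)) setT.
- by rewrite cardsT card_ord.
- have N0 : (0 < N)%N by rewrite /N; lia.
  pose h (i : 'I_N) : 'I_r := enum_val (cast_ord (esym cB) i).
  have hB i : h i \in B by apply: enum_valP.
  have h_inj : injective h by move=> i j /enum_val_inj/cast_ord_inj.
  pose i0 := Ordinal N0.
  have /choice[u uP] i : exists u, [/\ u \in M, u *m u ^t* = f (h i0) & u *m f (h i) = u].
    have [D DM D0] : exists2 D, D \in M & f (h i0) *m D *m f (h i) != 0.
      have [->|ne] := eqVneq i i0.
        by exists 1%:M => //; have [_ p0 pp _ _] := fmin (h i0); rewrite mulmx1 pp.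
      by apply/asboolP; apply: clique => //; rewrite (inj_eq h_inj) eq_sym.
    exact: partial_isometry DM D0.
  apply: (homogeneous_equivalent (u := u) k0 (leqnn N) (fmin (h i0))).
    by move=> i; case: (uP i).
  move=> i j; have [<-|ne] := eqVneq i j; first by case: (uP i).
  have [_ _ <-] := uP i; have [_ _ <-] := uP j.
  rewrite adjointM fadj mulmxA -(mulmxA (u i)) forth ?(inj_eq h_inj) //.
  by rewrite mulmx0 mul0mx.
have [B2 [sB2 cB2] B2V] : exists2 B2 : {set 'I_r}, B2 \subset B /\ #|B2| = k &
    {in B2 &, forall i j, i != j -> linked V i j} \/
    {in B2 &, forall i j, i != j -> ~~ linked V i j}.
  have [|[B2 ? ?]|[B2 ? ?]] := @ramsey_graph _ _ (linked_sym V Vadj) k k B.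
  - by rewrite cB.
  - by exists B2; last left.
  - by exists B2; last right.
pose h (i : 'I_k) : 'I_r := enum_val (cast_ord (esym cB2) i).
have hB i : h i \in B2 by apply: enum_valP.
have h_inj : injective h by move=> i j /enum_val_inj/cast_ord_inj.
have hne i j : i != j -> h i != h j by rewrite (inj_eq h_inj).
apply: (@homogeneous_inequivalent k (fun i => f (h i))) => [//|i j /hne|i j /hne ne|].
- exact: forth.
- by apply: notlinked; apply: anti => //; apply: (subsetP sB2).
case: B2V => B2V; [left | right] => i j /hne ne.
  by apply/asboolP; apply: B2V.
by apply: notlinked; apply: B2V.
Qed.

End OperatorBimodule.

(** * The theorem, in terms of ['C(M)] and [compression] *)

Theorem theorem5p4 (R : realType) (k : nat) (hk : (1 <= k)%N) :
  exists m : nat,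
    forall M V : {vspace 'M[R[i]]_m.+1},
      unital_star_subalgebra M ->
      operator_system V ->
      bimodule_over 'C(M)%VS V ->
      exists P : 'M[R[i]]_m.+1,
        [/\ P \in M,
            orthogonal_projection P,
            (k <= \rank P)%N
          & compression P V = compression P fullv \/
            compression P V = compression P 'C(M)%VS].
Proof.
(* The matrix size is one more than this number, hence above the bound. *)
exists (2 ^ (k * 2 ^ (2 * (k * k)) + 8 * k + 2 ^ (k + k)) * k)%N.
move=> M V [M1 MM Madj] [V1 Vadj] bimod.
have commE A : commutes_with M A <-> A \in 'C(M)%VS.
  by split=> [cA|/centvP cA D DM]; [apply/centvP => D DM; apply: cA | apply: cA].
have [|P [PM PP Padj rankP hom]] :=
    @bimodule_ramsey _ _ M V M1 MM Madj V1 Vadj _ k hk (leqnSn _).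
  by move=> A X B /commE AC XV /commE BC; apply: bimod.
exists P; split=> //.
have compE S : compression P S = (conjugation P @: S)%VS.
  apply/vspaceP => X; apply/compressionP/memv_imgP => -[A AS ->];
    by exists A => //; rewrite conjugationE Padj.
case: hom => [full|commV]; [left | right].
  by apply/eqP; rewrite eqEsubv !compE full limgS ?subvf.
apply/vspaceP => X; apply/compressionP/compressionP => -[A AS ->].
  by have [B /commE BC ->] := commV A AS; exists B.
(* The commutant lies in [V], as [A] times the identity of [V]. *)
exists A => //; rewrite -[A]mulmx1 -[A *m _]mulmx1; apply: bimod => //.
by apply/centvP => D _; rewrite mul1r mulr1.
Qed.
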